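(* Suppose $\mathcal{G}$ is connected and $\mathcal{E}_\mathcal{H}$ is non-empty. Then there exists $\epsilon_0>0$ such that $M(\epsilon)$ is positive definite for every $\epsilon$ with $0<\epsilon<\epsilon_0$. Moreover, the eigenvalue $\mu_0(\epsilon)$ of $M(\epsilon)$ that perturbs from the (simple) zero eigenvalue of $L_\mathcal{G}$ satisfies, as $\epsilon\to0^+$, $$\mu_0(\epsilon)=\epsilon\,\frac{2\,\#\mathcal{E}_\mathcal{H}}{n}+O(\epsilon^2).$$
   Context: Let $\mathcal{F}=\{\mathcal{V},\mathcal{E}\}$ be a simple undirected graph with $\mathcal{V}=\{1,\dots,n\}$. Let $\mathcal{G}=\{\mathcal{V},\mathcal{E}_\mathcal{G}\}$ and $\mathcal{H}=\{\mathcal{V},\mathcal{E}_\mathcal{H}\}$ be subgraphs of $\mathcal{F}$ on the same vertex set with $\mathcal{E}_\mathcal{G}\cap\mathcal{E}_\mathcal{H}=\emptyset$ and $\mathcal{E}_\mathcal{G}\cup\mathcal{E}_\mathcal{H}=\mathcal{E}$. For a real parameter $\epsilon>0$ define the symmetric $n\times n$ matrix $M(\epsilon)=L_\mathcal{G}+\epsilon A_\mathcal{H}$, where $L_\mathcal{G}$ is the Laplacian matrix of $\mathcal{G}$ (degree matrix minus adjacency matrix) and $A_\mathcal{H}$ is the $0/1$ adjacency matrix of $\mathcal{H}$. $\#\mathcal{E}_\mathcal{H}$ denotes the number of edges of $\mathcal{H}$. The eigenvalue $\mu_0(\epsilon)$ is the one with $\mu_0(\epsilon)\to0$ as $\epsilon\to0^+$.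 *)

(* Defs.v *)
From mathcomp Require Import all_boot all_order all_algebra.
From mathcomp Require Import all_classical all_reals all_analysis.
Import Order.TTheory GRing.Theory Num.Theory.
Import numFieldNormedType.Exports.

Set Implicit Arguments.
Unset Strict Implicit.
Unset Printing Implicit Defensive.

Local Open Scope classical_set_scope.
Local Open Scope ring_scope.

Record sgraph (n : nat) := SGraph {
  adj :> rel 'I_n;
  adj_sym : symmetric adj;
  adj_irrefl : irreflexive adj
}.

(* Edges are unordered pairs, so that #|edges g| counts each edge once. *)
Definition edges n (g : sgraph n) : {set {set 'I_n}} :=
  [set [set p.1; p.2]%SET | p : 'I_n * 'I_n & g p.1 p.2]%SET.

Definition subgraph n (g f : sgraph n) : bool := edges g \subset edges f.

(* [connect g] is the reflexive-transitive closure of adjacency. *)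
Definition connected_graph n (g : sgraph n) : Prop :=
  forall i j : 'I_n, connect g i j.

Definition degree n (g : sgraph n) (i : 'I_n) : nat :=
  #|[set j | g i j]%SET|.

Definition adjacency_mx (R : realType) n (g : sgraph n) : 'M[R]_n :=
  \matrix_(i, j) (g i j)%:R.

Definition degree_mx (R : realType) n (g : sgraph n) : 'M[R]_n :=
  diag_mx (\row_i (degree g i)%:R).

Definition laplacian_mx (R : realType) n (g : sgraph n) : 'M[R]_n :=
  degree_mx R g - adjacency_mx R g.

Definition perturbed_mx (R : realType) n (G H : sgraph n) (eps : R) : 'M[R]_n :=
  laplacian_mx R G + eps *: adjacency_mx R H.

Definition posdef_mx (R : realType) n (A : 'M[R]_n) : Prop :=
  A^T = A /\ forall x : 'cV[R]_n, x != 0 -> 0 < (x^T *m A *m x) 0 0.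

(* Algebraic multiplicity one, i.e. a simple root of the characteristic
   polynomial. *)
Definition simple_eigenvalue (R : realType) n (A : 'M[R]_n) (a : R) : Prop :=
  mup a (char_poly A) = 1%N.

(* Only the germ of [mu] at 0^+ matters: [mu eps] need not be an eigenvalue for
   large or nonpositive [eps]. *)
Definition zero_eigenvalue_branch (R : realType) n (M : R -> 'M[R]_n)
    (mu : R -> R) : Prop :=
  (\forall eps \near 0^'+, eigenvalue (M eps) (mu eps)) /\
  mu eps @[eps --> 0^'+] --> (0 : R).

(* Main.v *)
(* Write the eigenvector as [a *: ones + y] with [y] orthogonal to [ones].
   Connectedness gives a spectral gap [c * |y|^2 <= y L y^T] with [c > 0], so an
   eigenvector for an eigenvalue near [0] has [|y| = O(eps * |a|)]. Pairing the
   eigenvalue equation with [ones] yields [mu = eps * (ones A ones^T) / n + O(eps^2)],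
   and [ones A ones^T] is twice the number of edges of [H]. Two distinct
   eigenvalues near [0] would have orthogonal eigenvectors, which is impossible when
   both are close to multiples of [ones]. Existence of the branch is an
   intermediate value argument on the characteristic polynomial. *)
Require Import Defs.
From mathcomp Require Import all_boot all_order all_algebra.
From mathcomp Require Import all_classical all_reals all_analysis.
From mathcomp Require Import ring lra.
Import Order.TTheory GRing.Theory Num.Theory.
Import numFieldNormedType.Exports.

Local Open Scope classical_set_scope.
Local Open Scope ring_scope.

(** * Bilinear forms, the dot product and elementary bounds *)

(** Arguments are row vectors because [eigenvalue] refers to left eigenvectors [u *m A = a *: u]. *)
Definition bilin {R : comNzRingType} {n : nat} (A : 'M[R]_n) (u v : 'rV[R]_n) : R :=
  (u *m A *m v^T) 0 0.

Local Notation dot := (bilin 1%:M).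
Local Notation ones := (const_mx 1).

Lemma bilinE {R : comNzRingType} {n : nat} (A : 'M[R]_n) u v :
  bilin A u v = \sum_i \sum_j u 0 i * A i j * v 0 j.
Proof.
rewrite /bilin mxE exchange_big; apply: eq_bigr => j _.
by rewrite !mxE mulr_suml.
Qed.

Lemma dotE {R : comNzRingType} {n : nat} (u v : 'rV[R]_n) :
  dot u v = \sum_i u 0 i * v 0 i.
Proof. by rewrite /bilin mulmx1 mxE; apply: eq_bigr => i _; rewrite mxE. Qed.

Lemma bilinDl {R : comNzRingType} {n : nat} (A : 'M[R]_n) u v w :
  bilin A (u + v) w = bilin A u w + bilin A v w.
Proof. by rewrite /bilin !mulmxDl mxE. Qed.

Lemma bilinZl {R : comNzRingType} {n : nat} (A : 'M[R]_n) a u w :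
  bilin A (a *: u) w = a * bilin A u w.
Proof. by rewrite /bilin -!scalemxAl mxE. Qed.

Lemma bilinDr {R : comNzRingType} {n : nat} (A : 'M[R]_n) u v w :
  bilin A w (u + v) = bilin A w u + bilin A w v.
Proof. by rewrite /bilin linearD mulmxDr mxE. Qed.

Lemma bilinZr {R : comNzRingType} {n : nat} (A : 'M[R]_n) a u w :
  bilin A w (a *: u) = a * bilin A w u.
Proof. by rewrite /bilin linearZ -scalemxAr mxE. Qed.

Lemma bilinDmx {R : comNzRingType} {n : nat} (A B : 'M[R]_n) u v :
  bilin (A + B) u v = bilin A u v + bilin B u v.
Proof. by rewrite /bilin mulmxDr mulmxDl mxE. Qed.

Lemma bilinZmx {R : comNzRingType} {n : nat} a (A : 'M[R]_n) u v :
  bilin (a *: A) u v = a * bilin A u v.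
Proof. by rewrite /bilin -scalemxAr -scalemxAl mxE. Qed.

Lemma bilinC {R : comNzRingType} {n : nat} (A : 'M[R]_n) u v :
  A^T = A -> bilin A u v = bilin A v u.
Proof.
move=> sA; rewrite /bilin -[in RHS]sA.
suff -> : v *m A^T *m u^T = (u *m A *m v^T)^T by rewrite [RHS]mxE.
by rewrite !trmx_mul trmxK mulmxA.
Qed.

Lemma dotC {R : comNzRingType} {n : nat} (u v : 'rV[R]_n) : dot u v = dot v u.
Proof. by apply: bilinC; rewrite trmx1. Qed.

Lemma bilin_eigenl {R : comNzRingType} {n : nat} (A : 'M[R]_n) a u v :
  u *m A = a *: u -> bilin A u v = a * dot u v.
Proof. by rewrite /bilin mulmx1 => ->; rewrite -scalemxAl mxE. Qed.

Lemma dot_onesl {R : comNzRingType} {n : nat} (u : 'rV[R]_n) :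
  dot ones u = \sum_i u 0 i.
Proof. by rewrite dotE; apply: eq_bigr => i _; rewrite mxE mul1r. Qed.

Lemma dot_ones {R : comNzRingType} {n : nat} : dot (ones : 'rV[R]_n) ones = n%:R.
Proof.
by rewrite dot_onesl (eq_bigr (fun=> 1)) ?sumr_const ?card_ord // => i _; rewrite mxE.
Qed.

Lemma dot_ge0 {R : realDomainType} {n : nat} (u : 'rV[R]_n) : 0 <= dot u u.
Proof. by rewrite dotE; apply: sumr_ge0 => i _; rewrite -expr2 sqr_ge0. Qed.

Lemma dot_eq0 {R : realDomainType} {n : nat} (u : 'rV[R]_n) :
  dot u u = 0 -> u = 0.
Proof.
rewrite dotE => /eqP; rewrite psumr_eq0 => [/allP u0|i _]; last first.
  by rewrite -expr2 sqr_ge0.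
apply/rowP => i; rewrite mxE; apply/eqP.
by have := u0 i (mem_index_enum _); rewrite -expr2 sqrf_eq0.
Qed.

(* [|u|^2 |v|^2 - (u.v)^2] is half of [\sum_(i, j) (u_i v_j - u_j v_i)^2] (Lagrange). *)
Lemma dot_CauchySchwarz {R : realDomainType} {n : nat} (u v : 'rV[R]_n) :
  dot u v ^+ 2 <= dot u u * dot v v.
Proof.
have : 0 <= \sum_i \sum_j (u 0 i * v 0 j - u 0 j * v 0 i) ^+ 2.
  by apply: sumr_ge0 => i _; apply: sumr_ge0 => j _; exact: sqr_ge0.
suff -> : \sum_i \sum_j (u 0 i * v 0 j - u 0 j * v 0 i) ^+ 2 =
    2 * (dot u u * dot v v - dot u v ^+ 2).
  by rewrite pmulr_rge0 ?ltr0n // subr_ge0.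
rewrite expr2 !dotE !big_distrlr /=.
pose s (f : 'I_n -> 'I_n -> R) := \sum_i \sum_j f i j.
transitivity (s (fun i j : 'I_n => u 0 i * u 0 i * (v 0 j * v 0 j))
   + s (fun i j => u 0 j * u 0 j * (v 0 i * v 0 i))
   - 2 * s (fun i j => u 0 i * v 0 i * (u 0 j * v 0 j))).
  rewrite /s mulr_sumr -big_split /= -sumrB; apply: eq_bigr => i _.
  rewrite mulr_sumr -big_split /= -sumrB; apply: eq_bigr => j _; ring.
by rewrite /s [X in _ + X - _]exchange_big /=; ring.
Qed.

(** By AM-GM each [|u_i| |u_j|] is at most the mean of two squares, and every square is at most
    [dot u u]. *)
Lemma bilin_bound {R : realDomainType} {n : nat} (A : 'M[R]_n) (u : 'rV[R]_n) :
  `|bilin A u u| <= (\sum_i \sum_j `|A i j|) * dot u u.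
Proof.
have le_dot i : `|u 0 i| ^+ 2 <= dot u u.
  rewrite dotE (bigD1 i) //= real_normK ?num_real // expr2 lerDl.
  by apply: sumr_ge0 => j _; rewrite -expr2 sqr_ge0.
rewrite bilinE mulr_suml; apply: le_trans (ler_norm_sum _ _ _) _.
apply: ler_sum => i _; rewrite mulr_suml; apply: le_trans (ler_norm_sum _ _ _) _.
apply: ler_sum => j _; rewrite mulrAC normrM mulrC ler_wpM2l // normrM.
have := le_dot i; have := le_dot j.
have := sqr_ge0 (`|u 0 i| - `|u 0 j|); nra.
Qed.

Lemma bilin_ones_bound {R : realDomainType} {n : nat} (A : 'M[R]_n) (u : 'rV[R]_n) :
  bilin A ones u ^+ 2 <= dot (ones *m A) (ones *m A) * dot u u.
Proof.
suff -> : bilin A ones u = dot (ones *m A) u by exact: dot_CauchySchwarz.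
by rewrite /bilin mulmx1.
Qed.

Lemma ones_decomp {R : numFieldType} {n : nat} (x : 'rV[R]_n) : (0 < n)%N ->
  exists a y, x = a *: ones + y /\ dot ones y = 0.
Proof.
(* [a] is the mean of the entries of [x], so subtracting it leaves entries that sum to zero. *)
move=> n0; pose a := (dot ones x) / n%:R.
exists a, (x - a *: ones); split; first by rewrite addrC subrK.
rewrite bilinDr -scaleNr bilinZr dot_ones mulNr divfK ?subrr //.
by rewrite pnatr_eq0 -lt0n.
Qed.

(** * The Laplacian quadratic form and its spectral gap *)

Lemma degreeE {R : realType} {n : nat} (g : sgraph n) i :
  (degree g i)%:R = \sum_j (g i j)%:R :> R.
Proof.
rewrite /degree -sum1_card natr_sum big_mkcond; apply: eq_bigr => j _ /=.
by rewrite inE; case: (g i j).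
Qed.

Lemma adjacency_mx_tr {R : realType} {n : nat} (g : sgraph n) :
  (adjacency_mx R g)^T = adjacency_mx R g.
Proof. by apply/matrixP => i j; rewrite !mxE adj_sym. Qed.

Lemma laplacian_mx_tr {R : realType} {n : nat} (g : sgraph n) :
  (laplacian_mx R g)^T = laplacian_mx R g.
Proof. by rewrite /laplacian_mx linearB /= tr_diag_mx adjacency_mx_tr. Qed.

Lemma ones_laplacian {R : realType} {n : nat} (g : sgraph n) :
  ones *m laplacian_mx R g = 0 :> 'rV_n.
Proof.
rewrite mulmxBr mul_mx_diag; apply/rowP => j; rewrite !mxE mul1r degreeE.
apply/eqP; rewrite subr_eq0; apply/eqP.
by apply: eq_bigr => i _; rewrite !mxE mul1r adj_sym.
Qed.

(** This is the Dirichlet energy; the factor 2 appears because the sum runs over ordered pairs and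
    meets each edge twice. *)
Lemma bilin_laplacian {R : realType} {n : nat} (g : sgraph n) (u : 'rV[R]_n) :
  2 * bilin (laplacian_mx R g) u u =
  \sum_i \sum_j (g i j)%:R * (u 0 i - u 0 j) ^+ 2.
Proof.
pose s (f : 'I_n -> 'I_n -> R) := \sum_i \sum_j f i j.
have -> : bilin (laplacian_mx R g) u u =
    s (fun i j => (g i j)%:R * u 0 i ^+ 2) - s (fun i j => (g i j)%:R * (u 0 i * u 0 j)).
  rewrite /laplacian_mx bilinDmx -scaleN1r bilinZmx mulN1r; congr (_ - _).
    rewrite /bilin mul_mx_diag mxE; apply: eq_bigr => i _.
    by rewrite !mxE degreeE -mulr_suml; ring.
  rewrite bilinE; apply: eq_bigr => i _; apply: eq_bigr => j _.
  by rewrite mxE; ring.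
transitivity (s (fun i j => (g i j)%:R * u 0 i ^+ 2) + s (fun i j => (g j i)%:R * u 0 j ^+ 2)
  - 2 * s (fun i j => (g i j)%:R * (u 0 i * u 0 j))).
  by rewrite /s [X in _ = _ + X - _]exchange_big /=; ring.
rewrite /s mulr_sumr -big_split /= -sumrB; apply: eq_bigr => i _.
rewrite mulr_sumr -big_split /= -sumrB; apply: eq_bigr => j _.
by rewrite [g j i]adj_sym; ring.
Qed.

Lemma bilin_laplacian_ge0 {R : realType} {n : nat} (g : sgraph n) (u : 'rV[R]_n) :
  0 <= bilin (laplacian_mx R g) u u.
Proof.
rewrite -(@pmulr_rge0 _ 2) // bilin_laplacian.
by do 2![apply: sumr_ge0 => ? _]; rewrite mulr_ge0 ?ler0n ?sqr_ge0.
Qed.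

Lemma edge_le_laplacian {R : realType} {n : nat} (g : sgraph n) (u : 'rV[R]_n) i j :
  g i j -> (u 0 i - u 0 j) ^+ 2 <= 2 * bilin (laplacian_mx R g) u u.
Proof.
move=> gij; rewrite bilin_laplacian (bigD1 i) //= (bigD1 j) //= gij mul1r -addrA lerDl.
apply: addr_ge0; last apply: sumr_ge0 => k _;
  by apply: sumr_ge0 => l _; rewrite mulr_ge0 ?ler0n ?sqr_ge0.
Qed.

(** Induction along a path from [i] to [j]; the constant depends on the path but not on [u]. *)
Lemma connect_le_laplacian {R : realType} {n : nat} (g : sgraph n) i j :
  connect g i j -> exists k : R, forall u : 'rV[R]_n,
    (u 0 i - u 0 j) ^+ 2 <= k * bilin (laplacian_mx R g) u u.
Proof.
case/connectP => p; elim: p i => [|l p IH] i /=.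
  by move=> _ ->; exists 0 => u; rewrite subrr expr0n mul0r.
case/andP => gil pl jl; have [k kP] := IH l pl jl.
(* From [(s + t)^2 <= 2 s^2 + 2 t^2]: the first edge contributes 2 * 2 and the rest of the path 2 *
   k. *)
exists (2 * k + 4) => u; have := kP u; have := edge_le_laplacian g u _ _ gil.
have := sqr_ge0 ((u 0 i - u 0 l) - (u 0 l - u 0 j)); nra.
Qed.

(** A Poincaré inequality: the path bounds are summed over all pairs of vertices, and for [u]
    orthogonal to [ones] the sum of all squared differences is [2 n |u|^2]. *)
Lemma laplacian_gap {R : realType} {n : nat} (g : sgraph n) :
  connected_graph g -> exists c : R, 0 < c /\ forall u : 'rV[R]_n, dot ones u = 0 ->
    c * dot u u <= bilin (laplacian_mx R g) u u.
Proof.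
move=> g_conn.
have /choice[k kP] : forall p : 'I_n * 'I_n, exists k : R, forall u : 'rV[R]_n,
    (u 0 p.1 - u 0 p.2) ^+ 2 <= k * bilin (laplacian_mx R g) u u.
  by move=> p; apply: connect_le_laplacian; exact: g_conn.
pose K := \sum_i \sum_j `|k (i, j)|.
have K0 : 0 <= K by do 2![apply: sumr_ge0 => ? _].
(* Adding 1 keeps the inverse positive even when [K] is 0. *)
exists (K + 1)^-1; split=> [|u u0]; first by rewrite invr_gt0; lra.
rewrite mulrC ler_pdivrMr; last lra.
have L0 := bilin_laplacian_ge0 g u.
have [n0|n_gt0] := posnP n.
  by subst n; rewrite dotE big_ord0 mulr_ge0 //; lra.
suff : 2 * n%:R * dot u u <= K * bilin (laplacian_mx R g) u u.
  have : 1 <= n%:R :> R by rewrite ler1n.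
  have := dot_ge0 u; nra.
rewrite mulr_suml; under [leRHS]eq_bigr do rewrite mulr_suml.
have -> : 2 * n%:R * dot u u = \sum_i \sum_j (u 0 i - u 0 j) ^+ 2.
  pose s (f : 'I_n -> 'I_n -> R) := \sum_i \sum_j f i j.
  transitivity (s (fun i j => u 0 i ^+ 2) + s (fun i j => u 0 j ^+ 2)
    - 2 * s (fun i j => u 0 i * u 0 j)).
    (* The cross terms factor as the square of the sum of the entries, which is zero. *)
    have -> : s (fun i j => u 0 i * u 0 j) = 0.
      rewrite /s -[LHS]big_distrlr /=.
      by move: u0; rewrite dot_onesl => ->; rewrite mul0r.
    rewrite /s [X in _ = _ + X - _]exchange_big /= dotE.
    under eq_bigr => i _ do rewrite sumr_const card_ord -mulr_natl expr2.
    by rewrite -mulr_sumr; ring.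
  rewrite /s mulr_sumr -big_split /= -sumrB; apply: eq_bigr => i _.
  by rewrite mulr_sumr -big_split /= -sumrB; apply: eq_bigr => j _; ring.
do 2![apply: ler_sum => ? _]; apply: le_trans (kP (_, _) u) _ => /=.
by rewrite ler_wpM2r // ler_norm.
Qed.

(** * Counting edges through the adjacency matrix *)

(** Handshake lemma: adjacent ordered pairs are fibred over edges by [f]. Symmetry puts both
    orderings in the fibre, and irreflexivity makes them distinct, so each fibre has two
    elements. *)
Lemma card_edges {n : nat} (g : sgraph n) :
  (\sum_i \sum_j g i j = 2 * #|edges g|)%N.
Proof.
pose D : {set 'I_n * 'I_n} := [set p | g p.1 p.2]%SET.
pose f (p : 'I_n * 'I_n) : {set 'I_n} := [set p.1; p.2]%SET.
have -> : edges g = (f @: D)%SET 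
  by apply/setP => e; apply/imsetP/imsetP => -[p gp ->]; exists p; rewrite // inE in gp *.
transitivity (\sum_(p in D) 1)%N.
  rewrite pair_big /= big_mkcond [RHS]big_mkcond /=; apply: eq_bigr => p _.
  by rewrite inE; case: (g _ _).
rewrite (partition_big_imset f) /= mulnC -sum_nat_const.
apply: eq_bigr => e /imsetP[[i j]]; rewrite inE /= => gij ->.
have neq_ij : i != j by apply: contraTneq gij => ->; rewrite adj_irrefl.
rewrite sum1_card (_ : 2%N = #|[set (i, j); (j, i)]%SET|); last first.
  by rewrite cards2 xpair_eqE negb_and neq_ij.
apply: eq_card => -[k l]; rewrite unfold_in /= !inE /= !xpair_eqE.
apply/andP/orP => [[gkl /eqP fE]|].
  have : k \in f (i, j) by rewrite -fE !inE eqxx.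
  have : l \in f (i, j) by rewrite -fE !inE eqxx orbT.
  rewrite !inE /= => /orP[]/eqP El /orP[]/eqP Ek; move: gkl;
    rewrite El Ek ?adj_irrefl // !eqxx; by [left|right].
case=> /andP[/eqP-> /eqP->]; first by rewrite gij eqxx.
by rewrite adj_sym gij /f /= finset.setUC eqxx.
Qed.

Lemma bilin_adjacency_ones {R : realType} {n : nat} (g : sgraph n) :
  bilin (adjacency_mx R g) ones ones = (2 * #|edges g|)%:R.
Proof.
rewrite bilinE -card_edges natr_sum; apply: eq_bigr => i _.
by rewrite natr_sum; apply: eq_bigr => j _; rewrite !mxE mul1r mulr1.
Qed.

(** * The characteristic polynomial near a simple zero root *)

(* Multiplying ['X - A] on the right by [E], i.e. adding all columns to the
   first one, turns the first column into ['X] times the all-ones column. *)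
Lemma char_poly_simple_root0 {F : fieldType} {n : nat} (A : 'M[F]_n.+1) :
    A *m ones^T = 0 :> 'cV_n.+1 ->
    (forall u : 'rV_n.+1, u *m A = 0 -> dot ones u = 0 -> u = 0) ->
  exists q, char_poly A = 'X * q /\ q.[0] != 0.
Proof.
move=> A1 kerA.
pose E : 'M[{poly F}]_n.+1 := \matrix_(i, j) ((j == 0) || (i == j))%:R.
pose D : 'M[{poly F}]_n.+1 := diag_mx (\row_j if j == 0 then 'X else 1).
pose B : 'M[{poly F}]_n.+1 := \matrix_(i, j) if j == 0 then 1 else char_poly_mx A i j.
have A1i i : \sum_j A i j = 0.
  have /colP/(_ i) := A1; rewrite !mxE => A1i; rewrite -[RHS]A1i.
  by apply: eq_bigr => j _; rewrite !mxE mulr1.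
have detE : \det E = 1.
  rewrite det_trig; first by rewrite big1 // => i _; rewrite mxE eqxx orbT.
  apply/is_trig_mxP => i j ij; rewrite mxE.
  by case: eqP ij => [->|_] //; case: eqP => [->|//]; rewrite ltnn.
have detD : \det D = 'X.
  rewrite det_diag big_ord_recl big1 ?mulr1; first by rewrite mxE.
  by move=> i _; rewrite mxE.
have EBD : char_poly_mx A *m E = B *m D.
  rewrite mul_mx_diag; apply/matrixP => i j; rewrite [LHS]mxE !mxE.
  have [-> | j0] := eqVneq j 0.
    rewrite mul1r; under eq_bigr do rewrite !mxE eqxx mulr1.
    rewrite sumrB -rmorph_sum A1i rmorph0 subr0 (bigD1 i) //= eqxx big1 ?addr0 // => k.
    by rewrite eq_sym => /negbTE ->.
  rewrite (bigD1 j) //= big1 ?addr0 => [|k kj]; first by rewrite !mxE (negbTE j0) eqxx !mulr1.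
  by rewrite !mxE (negbTE j0) (negbTE kj) mulr0.
exists (\det B); split.
  by have := congr1 determinant EBD; rewrite !det_mulmx detE detD mulr1 mulrC.
(* If [\det B] vanished at 0, [B] at 0 would have a left null vector [u]: its first column gives
   [dot ones u = 0], the others give [u *m A = 0] outside column 0. *)
apply/negP => /eqP B0.
have /eqP/det0P[u u0 uB] : \det (map_mx (horner_eval 0) B) = 0.
  by rewrite det_map_mx /= /horner_eval B0.
have uB0 : dot ones u = 0.
  have /rowP/(_ 0) := uB; rewrite dot_onesl !mxE => uB0; rewrite -[RHS]uB0.
  apply: eq_bigr => i _.
  by rewrite !mxE eqxx /horner_eval hornerC mulr1.
have uAj j : j != 0 -> (u *m A) 0 j = 0.
  move=> j0; have /rowP/(_ j) := uB; rewrite !mxE => uBj.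
  apply: oppr_inj; rewrite oppr0 -[RHS]uBj -sumrN; apply: eq_bigr => i _.
  rewrite !mxE (negbTE j0) /horner_eval hornerD hornerN hornerC hornerMn hornerX.
  by rewrite mul0rn sub0r mulrN.
suff uA : u *m A = 0 by rewrite (kerA u) ?eqxx in u0.
apply/rowP => j; rewrite [RHS]mxE; have [->|/uAj //] := eqVneq j 0.
(* The remaining entry vanishes too, since the entries of [u *m A] sum to zero. *)
have /rowP/(_ 0) : u *m A *m ones^T = 0 :> 'rV_1 by rewrite -mulmxA A1 mulmx0.
rewrite mxE (bigD1 0) //= big1 ?addr0; first by rewrite !mxE mulr1.
by move=> i i0; rewrite uAj ?mul0r.
Qed.

Lemma poly_divX {R : nzRingType} (p : {poly R}) :
  exists q c, p = q * 'X + c%:P.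
Proof. by elim/poly_ind: p => [|q c _]; [exists 0, 0; rewrite mul0r add0r|exists q, c]. Qed.

(** The order of [a] and [b] is left open: in the application it depends on the sign of [q.[0]]. The
    bound [|a| + |b|] covers both orders. *)
Lemma poly_root_between {R : rcfType} (p : {poly R}) a b : p.[a] <= 0 <= p.[b] ->
  exists t, `|t| <= `|a| + `|b| /\ root p t.
Proof.
move=> /andP[pa pb]; have [ab|/ltW ba] := leP a b.
  have [|t /andP[ta tb] pt] := poly_ivt (p := p) ab; first by rewrite pa.
  exists t; split=> //; have := ler_norm b; have := ler_norm (- a).
  by rewrite normrN; case: (ger0P t); have := normr_ge0 a; have := normr_ge0 b; lra.
have [|t /andP[ta tb] pt] := poly_ivt (p := - p) ba.
  by rewrite !hornerE oppr_le0 oppr_ge0 pa pb.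
rewrite rootN in pt; exists t; split=> //; have := ler_norm a; have := ler_norm (- b).
by rewrite normrN; case: (ger0P t); have := normr_ge0 a; have := normr_ge0 b; lra.
Qed.

Lemma near_horner_gt0 {R : realType} (p : {poly R}) :
  0 < p.[0] -> \forall x \near 0^'+, 0 < p.[x].
Proof.
move=> p0; have : horner p x @[x --> 0^'+] --> p.[0].
  exact/cvg_at_right_filter/continuous_horner.
by move/cvgr_gt; apply.
Qed.

(* Along a line [t = k * eps] the characteristic polynomial of [A + eps *: B] is
   [eps] times a polynomial in [eps] whose constant term is a nonconstant affine
   function of [k]; so it changes sign between two such lines. *)
Lemma simple_root_branch {R : realType} {n : nat} (A B : 'M[R]_n) q :
    char_poly A = 'X * q -> q.[0] != 0 ->
  exists K : R, \forall eps \near 0^'+,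
    exists t, `|t| <= K * eps /\ eigenvalue (A + eps *: B) t.
Proof.
(* [char_poly N] is a bivariate polynomial: the outer variable is the eigenvalue, the inner one is
   [eps]. *)
move=> chA q0; pose N : 'M[{poly R}]_n := map_mx polyC A + 'X *: map_mx polyC B.
have chN eps : map_poly (horner_eval eps) (char_poly N) = char_poly (A + eps *: B).
  rewrite map_char_poly; congr char_poly; apply/matrixP => i j.
  by rewrite !mxE /= /horner_eval !hornerE.
(* In powers of the outer variable, [char_poly N] is [b0 + b1 X + P2 X^2]. At [eps = 0] it becomes
   ['X * q], so [b0] vanishes there and [b1] takes the value [q.[0]]. *)
have [P1 [b0 chN0]] := poly_divX (char_poly N).
have [P2 [b1 P1E]] := poly_divX P1.
have [c0 [c1 b0E]] := poly_divX b0.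
have := chN 0; rewrite scale0r addr0 chA chN0 rmorphD rmorphM /= map_polyX map_polyC /=.
rewrite [horner_eval 0 b0]/horner_eval => ch0.
have b00E : b0.[0] = 0 by have := congr1 (horner^~ 0) ch0; rewrite !hornerE.
have b1E : b1.[0] = q.[0].
  move: ch0; rewrite b00E polyC0 addr0 mulrC => /mulfI - /(_ (negbT (polyX_eq0 _))).
  move/(congr1 (horner^~ 0)); rewrite P1E rmorphD rmorphM /= map_polyX map_polyC /=.
  by rewrite /horner_eval !hornerE.
have c1_0 : c1 = 0 by rewrite b0E !hornerE in b00E.
rewrite c1_0 polyC0 addr0 in b0E.
pose s k : {poly R} := (P2.[k *: 'X] * (k *: 'X) + b1) * k%:P + c0.
have sE k eps : (char_poly (A + eps *: B)).[k * eps] = eps * (s k).[eps].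
  have -> : k * eps = horner_eval eps (k *: 'X) by rewrite /horner_eval !hornerE.
  rewrite -chN horner_map /= chN0 P1E b0E /s /horner_eval.
  by rewrite !hornerE /=; ring.
have s0 k : (s k).[0] = q.[0] * k + c0.[0].
  by rewrite /s !hornerE b1E /=; ring.
(* The slopes solve [q.[0] * k + c0.[0] = 1] and [= -1]. *)
pose k1 := (1 - c0.[0]) / q.[0]; pose k2 := (-1 - c0.[0]) / q.[0].
exists (`|k2| + `|k1|).
have s1 : \forall eps \near 0^'+, 0 < (s k1).[eps].
  by apply: near_horner_gt0; rewrite s0 mulrC divfK // subrK.
have s2 : \forall eps \near 0^'+, 0 < (- s k2).[eps].
  by apply: near_horner_gt0; rewrite hornerN s0 mulrC divfK // subrK opprK.
near=> eps.
have eps0 : 0 < eps by near: eps; exact: nbhs_right_gt.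
have s1e : 0 < (s k1).[eps] by near: eps.
have s2e : 0 < (- s k2).[eps] by near: eps.
have [|t [tK tr]] := @poly_root_between _ (char_poly (A + eps *: B)) (k2 * eps) (k1 * eps).
  rewrite !sE pmulr_rge0 // pmulr_rle0 // (ltW s1e) andbT.
  by rewrite hornerN oppr_gt0 in s2e; exact: ltW.
exists t; split; last by rewrite eigenvalue_root_char.
by move: tK; rewrite !normrM (gtr0_norm eps0) -mulrDl.
Unshelve. all: by end_near. Qed.

(** * Perturbation estimates for a symmetric matrix with a spectral gap *)

(** Pairing the eigenvector equation with [y] makes the gap absorb every term in [|y|^2]; the
    surviving term [eps * a * bilin A ones y] is controlled by Cauchy-Schwarz. If [a] were 0, then
    [y] and hence [x] would vanish. *)
Lemma near_zero_eigenvector {R : realType} {n : nat} (L A : 'M[R]_n) (c : R) :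
    (0 < n)%N -> ones *m L = 0 :> 'rV_n -> 0 < c ->
    (forall u, dot ones u = 0 -> c * dot u u <= bilin L u u) ->
  exists C d : R, [/\ 0 < C, 0 < d & forall eps mu x,
    0 < eps < d -> `|mu| < d -> x *m (L + eps *: A) = mu *: x -> x != 0 ->
    exists a y, [/\ a != 0, x = a *: ones + y, dot ones y = 0 &
      dot y y <= C * (eps * a) ^+ 2]].
Proof.
move=> n0 L1 c0 gap.
pose K := \sum_i \sum_j `|A i j|; pose K2 := dot (ones *m A) (ones *m A).
have K_ge0 : 0 <= K by do 2![apply: sumr_ge0 => ? _].
have K2_ge0 : 0 <= K2 by exact: dot_ge0.
have C0 : 0 <= 4 * K2 / c ^+ 2 by rewrite divr_ge0 ?sqr_ge0 // mulr_ge0.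
(* The second constant keeps both [eps * K] and [mu] below [c / 4], so half of the gap survives. The
   first comes from squaring [lin]; its [+ 1] ensures positivity. *)
exists (4 * K2 / c ^+ 2 + 1), (c / (4 * (K + 1))); split.
- by rewrite ltr_wpDl.
- by rewrite divr_gt0 // mulr_gt0 //; lra.
move=> eps mu x /andP[eps0]; rewrite !ltr_pdivlMr; try by rewrite mulr_gt0 //; lra.
move=> epsc muc xM x0; have [a [y [xE y1]]] := ones_decomp x n0.
suff yC : dot y y <= (4 * K2 / c ^+ 2 + 1) * (eps * a) ^+ 2.
  exists a, y; split=> //; apply: contraNneq x0 => a0.
  move: yC; rewrite a0 mulr0 expr0n mulr0 => y_le0.
  rewrite xE a0 scale0r add0r; apply/eqP/dot_eq0.
  by apply/eqP; rewrite eq_le y_le0 dot_ge0.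
have Ly : bilin L y y + eps * (a * bilin A ones y + bilin A y y) = mu * dot y y.
  have := bilin_eigenl _ _ _ y xM; rewrite xE !(bilinDmx, bilinZmx, bilinDl, bilinZl) y1.
  have -> : bilin L ones y = 0 by rewrite /bilin L1 mul0mx mxE.
  by rewrite !mulr0 !add0r => <-.
have := gap y y1; have := bilin_bound A y; have := bilin_ones_bound A y.
rewrite -/K -/K2; have := dot_ge0 y; move: Ly (ler_norm mu).
move: (dot y y) (bilin L y y) (bilin A y y) (bilin A ones y) => q l b2 b1.
rewrite ler_norml => Ly mu_le q0 b1K /andP[b2l b2u] gapq.
have lin : c / 2 * q <= - (eps * a * b1).
  have : eps * - b2 <= eps * (K * q) by rewrite ler_pM2l //; lra.
  have : eps * K * q <= c / 4 * q by rewrite ler_wpM2r //; nra.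
  have : mu * q <= c / 4 * q by rewrite ler_wpM2r //; nra.
  lra.
have quad : (c / 2 * q) ^+ 2 <= (eps * a) ^+ 2 * K2 * q.
  have -> : (eps * a) ^+ 2 * K2 * q = (eps * a) ^+ 2 * (K2 * q) by ring.
  apply: (@le_trans _ _ ((eps * a) ^+ 2 * b1 ^+ 2)); last by rewrite ler_wpM2l ?sqr_ge0.
  have cq0 : 0 <= c / 2 * q by rewrite mulr_ge0 // divr_ge0 // ltW.
  by rewrite -exprMn -[leRHS]sqrrN lerXn2r // nnegrE (le_trans cq0).
(* Both sides of [quad] carry a factor [q], cancelled once [q = 0] is set aside. *)
have [->|q_neq0] := eqVneq q 0; first by rewrite mulr_ge0 ?sqr_ge0 // addr_ge0.
have q_gt0 : 0 < q by rewrite lt_def q_neq0.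
have : c ^+ 2 * q <= 4 * K2 * (eps * a) ^+ 2.
  by rewrite -(ler_pM2r q_gt0); nra.
rewrite -ler_pdivlMl ?exprn_gt0 // => /le_trans; apply.
have := sqr_ge0 (eps * a).
suff -> : (c ^+ 2)^-1 * (4 * K2 * (eps * a) ^+ 2) = (4 * K2 / c ^+ 2) * (eps * a) ^+ 2 by lra.
by ring.
Qed.

Lemma zero_branch_near {R : realType} {n : nat} (M : R -> 'M[R]_n) mu (d : R) :
    0 < d -> zero_eigenvalue_branch M mu ->
  \forall eps \near 0^'+, [/\ 0 < eps < d, `|mu eps| < d &
    exists x : 'rV_n, x *m M eps = mu eps *: x /\ x != 0].
Proof.
move=> d0 [eig mu0]; near=> eps; split.
- by apply/andP; split; near: eps; [exact: nbhs_right_gt|exact: nbhs_right_lt].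
- by near: eps; exact: cvgr0_norm_lt.
- have /eigenvalueP[x xM x0] : eigenvalue (M eps) (mu eps) by near: eps.
  by exists x.
Unshelve. all: by end_near. Qed.

(** On [a *: ones + y] the form has the positive term [eps * a^2 * e]; half of it pays for part of
    the cross term, and the gap of [L] pays for the rest. *)
Lemma posdef_near0 {R : realType} {n : nat} (L A : 'M[R]_n) (c : R) :
    (0 < n)%N -> L^T = L -> A^T = A -> ones *m L = 0 :> 'rV_n -> 0 < c ->
    (forall u, dot ones u = 0 -> c * dot u u <= bilin L u u) ->
    0 < bilin A ones ones ->
  exists eps0 : R, 0 < eps0 /\
    forall eps, 0 < eps < eps0 -> posdef_mx (L + eps *: A).
Proof.
move=> n0 sL sA L1 c0 gap e0.
pose K := \sum_i \sum_j `|A i j|; pose K2 := dot (ones *m A) (ones *m A).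
have K_ge0 : 0 <= K by do 2![apply: sumr_ge0 => ? _].
have K2_ge0 : 0 <= K2 by exact: dot_ge0.
(* In [K3], [K] bounds [bilin A y y], [2 * K2 / e] comes from the cross term, and 1 leaves the
   margin [eps * q] needed when [a = 0]. *)
pose e := bilin A ones ones; pose K3 := K + 2 * K2 / e + 1.
have K30 : 0 < K3 by rewrite ltr_wpDl // addr_ge0 // divr_ge0 ?mulr_ge0 // ltW.
exists (c / K3); split=> [|eps /andP[eps0]]; first exact: divr_gt0.
rewrite ltr_pdivlMr // => epsK; split=> [|x x0]; first by rewrite linearD linearZ /= sL sA.
have [a [y [xE y1]]] := ones_decomp x^T n0.
have -> : (x^T *m (L + eps *: A) *m x) 0 0 = bilin (L + eps *: A) x^T x^T.
  by rewrite /bilin trmxK.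
have L1u u : bilin L ones u = 0 by rewrite /bilin L1 mul0mx mxE.
have -> : bilin (L + eps *: A) x^T x^T =
    bilin L y y + eps * (a ^+ 2 * e + 2 * (a * bilin A ones y) + bilin A y y).
  rewrite xE !(bilinDmx, bilinZmx, bilinDl, bilinZl, bilinDr, bilinZr).
  by rewrite (bilinC L y ones sL) (bilinC A y ones sA) !L1u -/e; ring.
have ay0 : a = 0 -> dot y y <> 0.
  move=> a0 /dot_eq0 y0; move/eqP: x0; apply; apply: trmx_inj.
  by rewrite xE a0 y0 scale0r addr0 trmx0.
have := gap y y1; have := bilin_bound A y; have := bilin_ones_bound A y.
rewrite -/K -/K2; have := dot_ge0 y; move: ay0.
move: (dot y y) (bilin L y y) (bilin A y y) (bilin A ones y) => q l b2 b1.
rewrite ler_norml => ay0 q0 b1K /andP[b2l b2u] gapq.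
(* Completing the square in [a] with weight [e / 2]. *)
have cross : - (2 * (a * b1)) <= e / 2 * a ^+ 2 + (2 * K2 / e) * q.
  have : 0 <= e / 2 * (a + 2 / e * b1) ^+ 2 by rewrite mulr_ge0 ?sqr_ge0 // divr_ge0 // ltW.
  have -> : e / 2 * (a + 2 / e * b1) ^+ 2 = e / 2 * a ^+ 2 + 2 * (a * b1) + 2 / e * b1 ^+ 2.
    by field; rewrite gt_eqF.
  have : 2 / e * b1 ^+ 2 <= 2 / e * (K2 * q) by rewrite ler_wpM2l // divr_ge0 // ltW.
  have -> : 2 * K2 / e * q = 2 / e * (K2 * q) by ring.
  lra.
have lower : eps * (e / 2 * a ^+ 2 - (K3 - 1) * q) <=
    eps * (a ^+ 2 * e + 2 * (a * b1) + b2).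
  rewrite ler_pM2l // /K3; lra.
apply: lt_le_trans (lerD gapq lower).
have -> : c * q + eps * (e / 2 * a ^+ 2 - (K3 - 1) * q) =
  (c - eps * K3) * q + eps * q + eps * (e / 2 * a ^+ 2) by ring.
have cq : 0 <= (c - eps * K3) * q by rewrite mulr_ge0 // subr_ge0 ltW.
have [a0|a0] := eqVneq a 0.
  have q_gt0 : 0 < q by rewrite lt_def q0 andbT; apply/eqP; exact: ay0.
  by rewrite a0 expr0n !mulr0 addr0 ltr_wpDl // mulr_gt0.
have eq0 : 0 <= eps * q by rewrite mulr_ge0 // ltW.
rewrite ltr_wpDl ?(addr_ge0 cq eq0) //.
by rewrite mulr_gt0 // mulr_gt0 ?divr_gt0 // exprn_even_gt0.
Qed.

Lemma zero_branch_unique {R : realType} {n : nat} (L A : 'M[R]_n) (c : R) mu0 mu1 :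
    (0 < n)%N -> L^T = L -> A^T = A -> ones *m L = 0 :> 'rV_n -> 0 < c ->
    (forall u, dot ones u = 0 -> c * dot u u <= bilin L u u) ->
    zero_eigenvalue_branch (fun eps => L + eps *: A) mu0 ->
    zero_eigenvalue_branch (fun eps => L + eps *: A) mu1 ->
  \forall eps \near 0^'+, mu0 eps = mu1 eps.
Proof.
move=> n0 sL sA L1 c0 gap br0 br1.
have [C [d [C0 d0 Cd]]] := near_zero_eigenvector L A c n0 L1 c0 gap.
(* Below this threshold [eps^2 * C < 1]. Orthogonality and Cauchy-Schwarz will give
   [n <= eps^2 * C], contradicting [1 <= n]. *)
have C1 : 0 < Num.min 1 C^-1 by rewrite lt_min ltr01 invr_gt0.
have near0 := zero_branch_near _ _ _ d0 br0.
have near1 := zero_branch_near _ _ _ d0 br1.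
near=> eps.
have [epsd mu0d [x [xM x0]]] : [/\ 0 < eps < d, `|mu0 eps| < d &
    exists x : 'rV_n, x *m (L + eps *: A) = mu0 eps *: x /\ x != 0] by near: eps.
have [_ mu1d [z [zM z0]]] : [/\ 0 < eps < d, `|mu1 eps| < d &
    exists x : 'rV_n, x *m (L + eps *: A) = mu1 eps *: x /\ x != 0] by near: eps.
have [a [y [a0 xE y1 yC]]] := Cd _ _ _ epsd mu0d xM x0.
have [b [w [b0 zE w1 wC]]] := Cd _ _ _ epsd mu1d zM z0.
have eps_small : eps < Num.min 1 C^-1 by near: eps; exact: nbhs_right_lt.
move: eps_small; rewrite lt_min => /andP[eps1]; rewrite -div1r ltr_pdivlMr // => epsC.
have /andP[eps0 _] := epsd.
apply/eqP; apply/negPn/negP => neq.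
have xz : dot x z = 0.
  apply/eqP; move: neq; rewrite -subr_eq0 => /mulfI/inj_eq <-; rewrite mulr0 mulrBl subr_eq0.
  rewrite -(bilin_eigenl _ _ _ z xM) dotC -(bilin_eigenl _ _ _ x zM) bilinC //.
  by rewrite linearD linearZ /= sL sA.
have yw : dot y w = - (a * b * n%:R).
  apply/eqP; rewrite -addr_eq0 addrC -xz xE zE !(bilinDl, bilinZl, bilinDr, bilinZr).
  by rewrite dot_ones w1 [dot y ones]dotC y1; apply/eqP; ring.
have n1 : 1 <= n%:R :> R by rewrite ler1n.
have /(le_trans (dot_CauchySchwarz _ _)) := ler_pM (dot_ge0 y) (dot_ge0 w) yC wC.
rewrite yw => ineq.
have ab : 0 < (a * b) ^+ 2 by rewrite lt_def sqrf_eq0 mulf_neq0 // sqr_ge0.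
have t0 : 0 <= eps * (eps * C) by rewrite !mulr_ge0 // ltW.
have t1 : eps * (eps * C) < 1 by nra.
have : (a * b) ^+ 2 * n%:R ^+ 2 <= (a * b) ^+ 2 * (eps * (eps * C)) ^+ 2.
  apply: le_trans (le_trans ineq _); rewrite le_eqVlt; apply/orP; left;
    by apply/eqP; ring.
rewrite ler_pM2l //; nra.
Unshelve. all: by end_near. Qed.

Lemma zero_branch_asymptotics {R : realType} {n : nat} (L A : 'M[R]_n) (c : R) mu :
    (0 < n)%N -> L^T = L -> A^T = A -> ones *m L = 0 :> 'rV_n -> 0 < c ->
    (forall u, dot ones u = 0 -> c * dot u u <= bilin L u u) ->
    zero_eigenvalue_branch (fun eps => L + eps *: A) mu ->
  mu = (fun eps => eps * (bilin A ones ones / n%:R)) +O_ (0^'+) (fun eps => eps ^+ 2).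
Proof.
move=> n0 sL sA L1 c0 gap br.
have [C [d [C0 d0 Cd]]] := near_zero_eigenvector L A c n0 L1 c0 gap.
have near0 := zero_branch_near _ _ _ d0 br.
pose K := dot (ones *m A) (ones *m A) * C; have K0 : 0 <= K by rewrite mulr_ge0 ?dot_ge0 // ltW.
apply/eqaddOP/bigO_exP => /=; exists (Num.sqrt K + 1); first by rewrite ltr_wpDl ?sqrtr_ge0.
near=> eps.
have [epsd mud [x [xM x0]]] : [/\ 0 < eps < d, `|mu eps| < d &
    exists x : 'rV_n, x *m (L + eps *: A) = mu eps *: x /\ x != 0] by near: eps.
have [a [y [a0 xE y1 yC]]] := Cd _ _ _ epsd mud xM x0.
have n_neq0 : n%:R != 0 :> R by rewrite pnatr_eq0 -lt0n.
have n1 : 1 <= n%:R :> R by rewrite ler1n.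
have /andP[eps0 _] := epsd.
(* Pairing the eigenvector equation with [ones] isolates the error [r]; it is second order because
   [y] itself is of order [eps * a]. *)
have muE : n%:R * a * (mu eps - eps * (bilin A ones ones / n%:R)) = eps * bilin A ones y.
  have := bilin_eigenl _ _ _ ones xM.
  have L1u u : bilin L ones u = 0 by rewrite /bilin L1 mul0mx mxE.
  rewrite xE !(bilinDmx, bilinZmx, bilinDl, bilinZl) [dot y ones]dotC y1 dot_ones.
  rewrite (bilinC L y ones sL) (bilinC A y ones sA) !L1u => muE.
  have -> : n%:R * a * (mu eps - eps * (bilin A ones ones / n%:R)) =
    mu eps * (a * n%:R + 0) - eps * a * bilin A ones ones by field.
  by rewrite -muE; ring.
rewrite !fctE /=; set r := mu eps - _ in muE *.
have r2 : r ^+ 2 <= K * (eps ^+ 2) ^+ 2.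
  have a2 : 0 < a ^+ 2 by rewrite lt_def sqrf_eq0 a0 sqr_ge0.
  rewrite -(ler_pM2l a2).
  have b1K : bilin A ones y ^+ 2 <= dot (ones *m A) (ones *m A) * (C * (eps * a) ^+ 2).
    by apply: le_trans (bilin_ones_bound A y) _; rewrite ler_wpM2l ?dot_ge0.
  have : (n%:R * a * r) ^+ 2 <= eps ^+ 2 * (dot (ones *m A) (ones *m A) * (C * (eps * a) ^+ 2)).
    by rewrite muE exprMn ler_wpM2l ?sqr_ge0.
  have -> : eps ^+ 2 * (dot (ones *m A) (ones *m A) * (C * (eps * a) ^+ 2)) =
    a ^+ 2 * (K * (eps ^+ 2) ^+ 2) by rewrite /K; ring.
  apply: le_trans; rewrite 2!exprMn -mulrA ler_peMl ?(mulr_ge0 (sqr_ge0 _) (sqr_ge0 _)) //.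
  exact: exprn_ege1.
rewrite -sqrtr_sqr [leRHS]mulrDl mul1r ler_wpDr // -[X in _ * X]sqrtr_sqr -sqrtrM //.
by rewrite ler_wsqrtr.
Unshelve. all: by end_near. Qed.

Theorem corollary2 (R : realType) (n : nat) (F G H : sgraph n)
    (GF : subgraph G F) (HF : subgraph H F)
    (GH_disjoint : (edges G :&: edges H)%SET = finset.set0)
    (GH_cover : (edges G :|: edges H)%SET = edges F)
    (G_connected : connected_graph G)
    (H_nonempty : edges H <> finset.set0) :
  (exists eps0 : R, 0 < eps0 /\
     forall eps : R, 0 < eps < eps0 -> posdef_mx (perturbed_mx G H eps)) /\
  simple_eigenvalue (laplacian_mx R G) 0 /\
  (exists mu0 : R -> R, zero_eigenvalue_branch (perturbed_mx G H) mu0) /\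
  (forall mu0 mu1 : R -> R,
     zero_eigenvalue_branch (perturbed_mx G H) mu0 ->
     zero_eigenvalue_branch (perturbed_mx G H) mu1 ->
     \forall eps \near 0^'+, mu0 eps = mu1 eps) /\
  (forall mu0 : R -> R,
     zero_eigenvalue_branch (perturbed_mx G H) mu0 ->
     mu0 = (fun eps : R => eps * ((2 * #|edges H|)%:R / n%:R))
             +O_ (0^'+) (fun eps : R => eps ^+ 2)).

Proof.
have edges_gt0 : (0 < #|edges H|)%N.
  by rewrite card_gt0; apply/eqP.
have n_gt0 : (0 < n)%N.
  rewrite lt0n; apply: contraTneq edges_gt0 => n0; rewrite -leqNgt.
  rewrite -(leq_pmul2l (isT : 0 < 2)%N) muln0 -card_edges.
  by rewrite big1 // => i; move: (ltn_ord i); rewrite [X in (_ < X)%N]n0.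
have [c [c0 gap]] := @laplacian_gap R n G G_connected.
have sL := @laplacian_mx_tr R _ G; have sA := @adjacency_mx_tr R _ H.
have L1 := @ones_laplacian R _ G.
have [q [chL q0]] : exists q, char_poly (laplacian_mx R G) = 'X * q /\ q.[0] != 0.
  (* The size is exposed as a successor so that a column 0 exists. *)
  case: n n_gt0 G c c0 gap sL L1 {F H GF HF GH_disjoint GH_cover G_connected
    H_nonempty edges_gt0 sA} => // m _ G c c0 gap sL L1.
  apply: char_poly_simple_root0 => [|u uL u1].
    by rewrite -sL -trmx_mul L1 trmx0.
  apply: dot_eq0; apply/eqP; rewrite eq_le dot_ge0 andbT -(pmulr_rle0 _ c0).
  by apply: le_trans (gap u u1) _; rewrite /bilin uL mul0mx mxE.
split.
  apply: (posdef_near0 _ _ c) => //.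
  by rewrite bilin_adjacency_ones ltr0n muln_gt0.
split.
  rewrite /simple_eigenvalue chL mulrC mupMr //.
  by have := mup_XsubCX 1 0 (0 : R); rewrite eqxx expr1 subr0.
split; last split.
- have [K Kroot] := simple_root_branch _ (adjacency_mx R H) q chL q0.
  pose P eps : set R := [set t | `|t| <= K * eps /\ eigenvalue (perturbed_mx G H eps) t].
  (* The branch chooses an eigenvalue with [|t| <= K * eps], defaulting to 0 where none exists; near
     [0^'+] one always does, and the bound forces convergence to 0. *)
  exists (fun eps => xget 0 (P eps)).
  have Pmu : \forall eps \near 0^'+, P eps (xget 0 (P eps)).
    by near=> eps; apply: xgetPex; near: eps.
  split; first by near=> eps; have [] : P eps (xget 0 (P eps)) by near: eps.
  have Kid : K * eps @[eps --> 0^'+] --> (0 : R).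
    by rewrite -[0 in X in _ --> X](mulr0 K); apply: cvgM;
      [exact: cvg_cst|exact/cvg_at_right_filter/cvg_id].
  apply: (@squeeze_cvgr _ _ _ _ (fun eps => - (K * eps)) (fun eps => K * eps)).
  + near=> eps; rewrite -ler_norml.
    by have [] : P eps (xget 0 (P eps)) by near: eps.
  + by rewrite -[0 in X in _ --> X]oppr0; exact: cvgN.
  + exact: Kid.
- move=> mu0 mu1; exact: (zero_branch_unique _ _ c).
- move=> mu0 br; rewrite -bilin_adjacency_ones.
  exact: (zero_branch_asymptotics _ _ c mu0 n_gt0 sL sA L1 c0 gap br).
Unshelve. all: by end_near. Qed.
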